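(* Let $r\ge 3$. Suppose that there are real numbers $a<b$ with $[a,b]\subseteq \Pi^{(r)}_\infty$. Then there exists $\delta>0$ such that $[1-\delta,1]\subseteq\Pi^{(r)}_\infty$.
   Context: An $r$-graph is a collection of $r$-element subsets of a vertex set. For a family $\mathcal F$ of $r$-graphs, $\mathrm{ex}(n,\mathcal F)$ is the maximum number of edges in an $n$-vertex $r$-graph containing no member of $\mathcal F$ as a subgraph, and $\pi(\mathcal F)=\lim_{n\to\infty}\mathrm{ex}(n,\mathcal F)/\binom nr$. $\Pi^{(r)}_\infty$ is the set of all $\pi(\mathcal F)$ over all (possibly infinite, possibly empty) families $\mathcal F$ of $r$-graphs; in particular $1\in\Pi^{(r)}_\infty$. *)

(* Defs.v *)
From mathcomp Require Export all_boot all_order all_algebra.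
From mathcomp Require Export boolp classical_sets set_interval reals.
From mathcomp Require Export topology normedtype sequences.

Set Implicit Arguments.
Unset Strict Implicit.
Unset Printing Implicit Defensive.

Import Order.TTheory GRing.Theory Num.Theory.
Import numFieldNormedType.Exports.

Local Open Scope classical_set_scope.
Local Open Scope ring_scope.

Definition edges_of_size (r : nat) (V : finType) (E : {set {set V}}) : Prop :=
  forall e, e \in E -> #|e| = r.

(* Vertex sets are normalised to 'I_n: r-graphs only matter up to isomorphism. *)
Record rgraph (r : nat) := RGraph {
  nvertices : nat;
  edges : {set {set 'I_nvertices}};
  edgesP : edges_of_size r edges
}.

(* Subgraphs are not necessarily induced, and are taken up to isomorphism. *)
Definition has_copy (r : nat) (F : rgraph r) (V : finType) (E : {set {set V}}) :
    Prop :=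
  exists2 f : 'I_(nvertices F) -> V, injective f &
    forall e, e \in edges F -> f @: e \in E.

Definition family_free (r : nat) (Fam : set (rgraph r)) (V : finType)
    (E : {set {set V}}) : Prop :=
  forall F, Fam F -> ~ has_copy F E.

(* If Fam has an edgeless member then, for large n, every n-vertex r-graph
   contains it, and the maximum over no graph is 0. *)
Definition ex_turan (r n : nat) (Fam : set (rgraph r)) : nat :=
  \max_(E : {set {set 'I_n}} | `[< edges_of_size r E /\ family_free Fam E >]) #|E|.

(* The ratio is nonincreasing in n for n >= r, so the limit always exists. *)
Definition turan_density (R : realType) (r : nat) (Fam : set (rgraph r)) : R :=
  limn (fun n : nat => (ex_turan n Fam)%:R / 'C(n, r)%:R : R).

Definition Pi_infty (R : realType) (r : nat) : set R :=
  range (@turan_density R r).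
Arguments Pi_infty : clear implicits.

(* Main.v *)
(** Fix a family F of density x > 0 and k >= 1. The r-graphs whose vertex set
    splits into k parts, each inducing an F-free r-graph, form a class closed
    under subgraphs, so they are the r-graphs free of some family F'. An
    extremal one contains every r-set meeting two parts, and by convexity the
    parts should be balanced; hence F' has density 1 - (1 - x) / k^(r-1).
    When x runs over [a, b] this covers an interval whose distances to 1 range
    from (1 - b) / k^(r-1) to (1 - a) / k^(r-1), and for large k consecutive
    intervals overlap, filling a left neighbourhood of 1. *)

Require Import Defs.
From mathcomp Require Import zify ring lra.

Set Implicit Arguments.
Unset Strict Implicit.
Unset Printing Implicit Defensive.

Import Order.TTheory GRing.Theory Num.Theory.
Import numFieldNormedType.Exports.

(** * Turan numbers: restriction to a vertex subset and averaging *)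

(* The copy, including its isolated vertices, must lie inside A. *)
Definition copy_in (r : nat) (F : rgraph r) (V : finType) (E : {set {set V}})
    (A : {set V}) : Prop :=
  exists f : 'I_(nvertices F) -> V,
    [/\ injective f, forall v, f v \in A &
        forall e, e \in edges F -> f @: e \in E].

(** Pulling back along [enum_val] turns the edges inside [A] into an [r]-graph on ['I_#|A|]; a copy
    found there pushes forward to one with all its vertices in [A]. *)
Lemma card_edges_in_le_ex (r : nat) (Fam : set (rgraph r)) (V : finType)
    (E : {set {set V}}) (A : {set V}) :
  edges_of_size r E -> (forall F, Fam F -> ~ copy_in F E A) ->
  #|[set e in E | e \subset A]| <= ex_turan #|A| Fam.
Proof.
move=> szE freeE.
have inj := @enum_val_inj V (mem A).
pose lift (e : {set 'I_#|A|}) := (fun i => enum_val i) @: e.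
pose E' := [set e | lift e \in E].
have subE : [set e in E | e \subset A] \subset lift @: E'.
  apply/fintype.subsetP => e; rewrite inE => /andP[eE eA].
  have le : lift [set i | enum_val i \in e] = e.
    apply/setP => v; apply/imsetP/idP => [[i]|ve].
      by rewrite inE => ie ->.
    have vA : v \in A by exact: (fintype.subsetP eA).
    by exists (enum_rank_in vA v); rewrite ?inE enum_rankK_in.
  by apply/imsetP; exists [set i | enum_val i \in e]; rewrite ?inE le.
apply: leq_trans (subset_leq_card subE) _.
apply: leq_trans (leq_imset_card _ _) _.
apply: (@leq_bigmax_cond _ _ (fun E : {set {set 'I_#|A|}} => #|E|) E').
apply/asboolP; split.
  by move=> e; rewrite inE => /szE; rewrite card_imset.
move=> F FamF [f injf copy]; apply: (freeE F FamF).
exists (fun v => enum_val (f v)); split.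
- by move=> u v /inj/injf.
- by move=> v; apply: enum_valP.
- by move=> e /copy; rewrite inE /lift -imset_comp.
Qed.

Lemma card_le_ex (r : nat) (Fam : set (rgraph r)) (V : finType)
    (E : {set {set V}}) :
  edges_of_size r E -> family_free Fam E -> #|E| <= ex_turan #|V| Fam.
Proof.
move=> szE freeE; rewrite -cardsT.
have subE : E \subset [set e in E | e \subset [set: V]%SET].
  by apply/fintype.subsetP => e eE; rewrite inE eE finset.subsetT.
apply: leq_trans (subset_leq_card subE) (card_edges_in_le_ex szE _).
by move=> F FamF [f [injf _ copy]]; apply: (freeE F FamF); exists f.
Qed.

Lemma ex_turan_leq (r n : nat) (Fam : set (rgraph r)) (m : nat) :
  (forall E : {set {set 'I_n}},
     edges_of_size r E -> family_free Fam E -> #|E| <= m) ->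
  ex_turan n Fam <= m.
Proof.
by move=> H; apply/bigmax_leqP => E /asboolP[szE freeE]; apply: H.
Qed.

Lemma card_ord_draws (n r : nat) :
  #|[set e : {set 'I_n} | #|e| == r]| = 'C(n, r).
Proof. by rewrite card_draws card_ord. Qed.

Lemma ex_turan_le_bin (r n : nat) (Fam : set (rgraph r)) :
  ex_turan n Fam <= 'C(n, r).
Proof.
apply: ex_turan_leq => E szE _.
rewrite -card_ord_draws; apply/subset_leq_card/fintype.subsetP => e eE.
by rewrite inE szE.
Qed.

Lemma ex_turan_set0 (r n : nat) : ex_turan n (@set0 (rgraph r)) = 'C(n, r).
Proof.
apply/eqP; rewrite eqn_leq ex_turan_le_bin -card_ord_draws.
have := @card_le_ex r set0 'I_n [set e : {set 'I_n} | #|e| == r].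
by rewrite card_ord; apply => // e; rewrite inE => /eqP.
Qed.

(* Katona--Nemetz--Simonovits: double count pairs (edge, vertex avoiding it). *)
Lemma ex_turan_delete_vertex (r n : nat) (Fam : set (rgraph r)) :
  (n.+1 - r) * ex_turan n.+1 Fam <= n.+1 * ex_turan n Fam.
Proof.
suff H (E : {set {set 'I_n.+1}}) : edges_of_size r E -> family_free Fam E ->
    (n.+1 - r) * #|E| <= n.+1 * ex_turan n Fam.
  case: (posnP (n.+1 - r)) => [->|r_lt]; first by rewrite mul0n.
  rewrite mulnC -leq_divRL //; apply: ex_turan_leq => E szE freeE.
  by rewrite leq_divRL // mulnC H.
move=> szE freeE.
have -> : (n.+1 - r) * #|E| = \sum_(v : 'I_n.+1) #|[set e in E | v \notin e]|.
  transitivity (\sum_(e in E) #|~: e|).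
    rewrite mulnC -sum_nat_const; apply: eq_bigr => e eE.
    by rewrite cardsCs finset.setCK card_ord szE.
  under [RHS]eq_bigr do rewrite -sum1_card.
  under eq_bigr do rewrite -sum1_card.
  rewrite (exchange_big_dep predT) //=; apply: eq_bigr => v _.
  by apply: eq_bigl => e; rewrite !inE.
have -> : n.+1 * ex_turan n Fam = \sum_(v : 'I_n.+1) ex_turan n Fam.
  by rewrite sum_nat_const card_ord.
apply: leq_sum => v _.
have -> : [set e in E | v \notin e] = [set e in E | e \subset ~: [set v]].
  by apply/setP => e; rewrite !inE finset.subsetC finset.sub1set inE.
have cardv : #|~: [set v]| = n by rewrite cardsC1 card_ord.
rewrite -[X in ex_turan X]cardv; apply: card_edges_in_le_ex => // F FamF.
by case=> f [injf _ copy]; apply: (freeE F FamF); exists f.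
Qed.

(** * The class of [r]-graphs that split into [k] free parts *)

Definition parts_free (r k : nat) (Fam : set (rgraph r)) (V : finType)
    (E : {set {set V}}) : Prop :=
  exists c : V -> 'I_k, forall i F, Fam F -> ~ copy_in F E [set v | c v == i].

(** Everything outside the class is forbidden. As the class is closed under subgraphs, its members
    are exactly the free graphs. *)
Definition partite_family (r k : nat) (Fam : set (rgraph r)) : set (rgraph r) :=
  fun F => ~ parts_free k Fam (edges F).

(** A copy [f] pulls a colouring [c] back to [c \o f], so a subgraph of a splitting graph splits. *)
Lemma parts_free_partite_family_free (r k : nat) (Fam : set (rgraph r))
    (V : finType) (E : {set {set V}}) :
  parts_free k Fam E -> family_free (partite_family k Fam) E.
Proof.
move=> [c freec] F FF [f injf copy]; apply: FF.
exists (c \o f) => i G FamG [g [injg gi copyg]]; apply: (freec i G FamG).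
exists (f \o g); split=> [u v /injf/injg//|v|e /copyg/copy].
  by have := gi v; rewrite !inE.
by rewrite -imset_comp.
Qed.

(** A graph that does not split is itself forbidden, and it contains itself through the identity. *)
Lemma partite_family_free_parts_free (r k n : nat) (Fam : set (rgraph r))
    (E : {set {set 'I_n}}) :
  edges_of_size r E -> family_free (partite_family k Fam) E ->
  parts_free k Fam E.
Proof.
move=> szE freeE; apply: contrapT => nE; apply: (freeE (RGraph szE) nE).
by exists id => // e; rewrite imset_id.
Qed.

(** A part of size [m] contains at least ['C(m, r) - ex_turan m Fam] non-edges of size [r]. A
    nonempty set lies in at most one part, so no non-edge is counted twice. Terms are moved across
    to avoid truncated subtraction. *)
Lemma card_parts_free_le (r k : nat) (Fam : set (rgraph r)) (V : finType)
    (E : {set {set V}}) (c : V -> 'I_k) : 0 < r -> edges_of_size r E ->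
  (forall i F, Fam F -> ~ copy_in F E [set v | c v == i]) ->
  #|E| + \sum_i 'C(#|[set v | c v == i]|, r) <=
    'C(#|V|, r) + \sum_i ex_turan #|[set v | c v == i]| Fam.
Proof.
move=> r_gt0 szE freeE; pose A i := [set v | c v == i].
pose B i := [set e : {set V} | (e \subset A i) && (#|e| == r)] :\: E.
have leB : \sum_i 'C(#|A i|, r) <=
    \sum_i #|B i| + \sum_i ex_turan #|A i| Fam.
  rewrite -big_split /=; apply: leq_sum => i _.
  rewrite -cards_draws -(cardsID E) addnC leq_add2l.
  apply: leq_trans (card_edges_in_le_ex szE (freeE i)).
  apply/subset_leq_card/fintype.subsetP => e; rewrite !inE.
  by case/andP => /andP[-> _] ->.
apply: leq_trans (leq_add (leqnn _) leB) _; rewrite addnA leq_add2r.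
have -> : \sum_i #|B i| = #|\bigcup_i B i|.
  under eq_bigr do rewrite -sum1_card.
  rewrite -sum1_card partition_disjoint_bigcup // => i j neq_ij.
  rewrite -setI_eq0; apply/eqP/setP => e; rewrite !inE.
  apply/negP => /andP[/and3P[_ /fintype.subsetP ei /eqP sze]].
  move=> /and3P[_ /fintype.subsetP ej _].
  have /card_gt0P[v ve] : 0 < #|e| by rewrite sze.
  have := ei v ve; have := ej v ve; rewrite !inE => /eqP -> /eqP ji.
  by rewrite ji eqxx in neq_ij.
have disj : E :&: \bigcup_i B i = finset.set0.
  apply/setP => e; rewrite !inE; apply/negP => /andP[eE /bigcupP[i _]].
  by rewrite !inE eE.
rewrite -cardsUI disj cards0 addn0 -card_draws.
apply/subset_leq_card/fintype.subsetP => e; rewrite !inE => /orP[/szE ->//|].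
by case/bigcupP => i _; rewrite !inE => /and3P[].
Qed.

(** * Convexity, and the Turan numbers of [partite_family] *)

(** ['C(q, r)] is the increment from [q] to [q + 1] of the sequence ['C(_, r.+1)], whose increments
    are nondecreasing; so the line through its point at [q] with that slope stays below it. *)
Lemma bin_tangent (q r m : nat) :
  'C(q, r.+1) + m * 'C(q, r) <= 'C(m, r.+1) + q * 'C(q, r).
Proof.
have up d : 'C(q, r.+1) + d * 'C(q, r) <= 'C(q + d, r.+1).
  elim: d => [|d IH]; first by rewrite addn0 mul0n addn0.
  rewrite mulSn addnCA addnS binS [leqRHS]addnC.
  by apply: leq_add => //; apply: leq_bin2l; apply: leq_addr.
have down d : d <= q -> 'C(q, r.+1) <= 'C(q - d, r.+1) + d * 'C(q, r).
  elim: d => [|d IH] dq; first by rewrite subn0 leq_addr.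
  apply: leq_trans (IH (ltnW dq)) _.
  rewrite -[q - d]prednK ?subn_gt0 // -subnS binS mulSn.
  rewrite -addnA leq_add2l leq_add2r; apply: leq_bin2l; exact: leq_subr.
case: (leqP q m) => qm.
  have := up (m - q); rewrite subnKC //; nia.
have := down (q - m) (leq_subr _ _); rewrite subKn ?(ltnW qm) //; nia.
Qed.

(* Jensen's inequality, from the tangent of the convex sequence at q. *)
Lemma sum_bin_ge (k q r : nat) (m : 'I_k -> nat) :
  0 < r -> \sum_i m i = k * q -> k * 'C(q, r) <= \sum_i 'C(m i, r).
Proof.
case: r => // r _ sum_m.
have : \sum_(i < k) ('C(q, r.+1) + m i * 'C(q, r)) <=
       \sum_(i < k) ('C(m i, r.+1) + q * 'C(q, r)).
  by apply: leq_sum => i _; apply: bin_tangent.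
rewrite !big_split /= -big_distrl /= sum_m !sum_nat_const card_ord mulnA.
by rewrite leq_add2r.
Qed.

(** Put an extremal graph on each of [k] blocks of size [q] and add all crossing [r]-sets. The
    hypothesis ensures that [ex_turan q Fam] is attained by a graph and is not the default 0. *)
Lemma ex_partite_family_ge (r k q : nat) (Fam : set (rgraph r)) :
  (exists E : {set {set 'I_q}}, edges_of_size r E /\ family_free Fam E) ->
  'C(k * q, r) + k * ex_turan q Fam <=
    ex_turan (k * q) (partite_family k Fam) + k * 'C(q, r).
Proof.
move=> [E0 [szE0 freeE0]].
have [E1] : {E | E \in (fun E : {set {set 'I_q}} =>
    `[< edges_of_size r E /\ family_free Fam E >]) & ex_turan q Fam = #|E|}.
  apply: eq_bigmax_cond; apply/card_gt0P; exists E0.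
  by rewrite unfold_in; apply/asboolP.
rewrite unfold_in => /asboolP[szE1 freeE1] ->.
pose V := ('I_k * 'I_q)%type.
pose A (i : 'I_k) : {set V} := [set v | v.1 == i].
pose E := [set e : {set V} | (#|e| == r) &&
  [forall i, (e \subset A i) ==> (snd @: e \in E1)]].
have szE : edges_of_size r E by move=> e; rewrite inE => /andP[/eqP].
have exE : #|E| <= ex_turan (k * q) (partite_family k Fam).
  have -> : k * q = #|{: V}| by rewrite card_prod !card_ord.
  apply: card_le_ex => //; apply: parts_free_partite_family_free.
  exists fst => i F FamF [f [injf fi copy]]; apply: (freeE1 F FamF).
  exists (snd \o f) => [u v /= uv|e eF].
    apply: injf; have := fi u; have := fi v; rewrite !inE => /eqP f1 /eqP f2.
    by rewrite [LHS]surjective_pairing [RHS]surjective_pairing f1 f2 uv.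
  have := copy e eF; rewrite inE => /andP[_ /forallP/(_ i)/implyP fE].
  rewrite (imset_comp snd f); apply: fE; apply/fintype.subsetP => _ /imsetP[v _ ->].
  exact: fi.
pose D := [set e : {set 'I_q} | #|e| == r] :\: E1.
have cardD : #|D| + #|E1| = 'C(q, r).
  rewrite -card_ord_draws -[RHS](cardsID E1) [RHS]addnC; congr addn.
  by apply: eq_card => e; rewrite !inE andb_idl // => /szE1 ->.
(* A missing [r]-set lies in one block, so it is determined by that block and a non-edge of the
   extremal graph. *)
have : #|[set e : {set V} | #|e| == r] :\: E| <= k * #|D|.
  have -> : k * #|D| = #|finset.setX [set: 'I_k] D|.
    by rewrite cardsX cardsT card_ord.
  pose g (p : 'I_k * {set 'I_q}) : {set V} := (fun x => (p.1, x)) @: p.2.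
  apply: leq_trans (leq_imset_card g _).
  apply/subset_leq_card/fintype.subsetP => e; rewrite !inE => /andP[+ /eqP sze].
  rewrite sze eqxx /= negb_forall => /existsP[i].
  rewrite negb_imply => /andP[/fintype.subsetP ei eE1].
  have snd_inj : {in e &, injective (@snd 'I_k 'I_q)}.
    move=> u v ue ve uv; have := ei u ue; have := ei v ve.
    rewrite !inE => /eqP f1 /eqP f2.
    by rewrite [LHS]surjective_pairing [RHS]surjective_pairing f1 f2 uv.
  apply/imsetP; exists (i, snd @: e).
    by rewrite !inE /= eE1 card_in_imset ?sze ?eqxx.
  rewrite /g /= -imset_comp -[LHS]imset_id; apply: eq_in_imset => v ve /=.
  by have := ei v ve; rewrite inE => /eqP <-; rewrite -surjective_pairing.
have : #|[set e : {set V} | #|e| == r]| <=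
    #|E| + #|[set e : {set V} | #|e| == r] :\: E|.
  rewrite -(cardsID E) leq_add2r; apply: subset_leq_card; exact: finset.subsetIr.
by rewrite card_draws card_prod !card_ord; nia.
Qed.

(** The [m i] are the part sizes of an extremal graph. *)
Lemma ex_partite_family_le (r k n : nat) (Fam : set (rgraph r)) :
  0 < r -> 0 < k -> exists2 m : 'I_k -> nat, \sum_i m i = n &
  ex_turan n (partite_family k Fam) + \sum_i 'C(m i, r) <=
    'C(n, r) + \sum_i ex_turan (m i) Fam.
Proof.
move=> r_gt0 k_gt0; pose P := fun E : {set {set 'I_n}} =>
  `[< edges_of_size r E /\ family_free (partite_family k Fam) E >].
case: (posnP #|P|) => [P0|P_gt0]; last first.
  have [E] := eq_bigmax_cond (fun E : {set {set 'I_n}} => #|E|) P_gt0.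
  rewrite unfold_in => /asboolP[szE freeE] maxE.
  have [c freec] := partite_family_free_parts_free szE freeE.
  exists (fun i => #|[set v | c v == i]|).
    rewrite -[RHS]card_ord -sum1_card (partition_big c xpredT) //=.
    apply: eq_bigr => i _; rewrite -sum1_card.
    by apply: eq_bigl => v; rewrite inE.
  rewrite [ex_turan n _]maxE.
  by have := card_parts_free_le r_gt0 szE freec; rewrite card_ord.
(* With no free graph at all the maximum is the default 0, and one part holding every vertex will
   do. *)
have ex0 : ex_turan n (partite_family k Fam) = 0.
  rewrite /ex_turan big1 // => E PE.
  by have := card0_eq P0 E; rewrite unfold_in /P PE.
exists (fun i => if i == Ordinal k_gt0 then n else 0).
  by rewrite -big_mkcond big_pred1_eq.
rewrite ex0 add0n (bigD1 (Ordinal k_gt0)) //= big1 ?addn0 ?leq_addr //.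
by move=> i /negPf ->; rewrite bin0n; case: r r_gt0 {Fam P P0 ex0}.
Qed.

(** * Turan density as a limit *)

Local Open Scope classical_set_scope.
Local Open Scope ring_scope.

Section Density.
Variables (R : realType) (r : nat) (Fam : set (rgraph r)).

Let ratio (n : nat) : R := (ex_turan n Fam)%:R / 'C(n, r)%:R.

(** Vertex deletion combined with [(m - r) C(m, r) = m C(m - 1, r)]. The shift by [r] skips the
    indices where the binomial vanishes and the quotient is 0 by convention. *)
Lemma turan_ratio_nonincreasing :
  {homo (fun n => ratio (n + r)) : n m / (n <= m)%N >-> m <= n}.
Proof.
apply/nonincreasing_seqP => n; rewrite /ratio addSn.
set m := (n + r)%N.
rewrite ler_pdivrMr ?ltr0n ?bin_gt0; last by rewrite /m; lia.
rewrite mulrAC ler_pdivlMr ?ltr0n ?bin_gt0; last by rewrite /m; lia.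
rewrite -!natrM ler_nat.
have := ex_turan_delete_vertex m Fam; have := mul_bin_down m.+1 r.
have -> : (m.+1 - r = n.+1)%N by rewrite /m; lia.
rewrite /= => binm exm.
rewrite -(@leq_pmul2l n.+1) // mulnA.
apply: leq_trans (leq_mul exm (leqnn _)) _.
by rewrite mulnAC binm; lia.
Qed.

Lemma turan_ratio_cvg : ratio @ \oo --> turan_density R Fam.
Proof.
have : cvgn (fun n => ratio (n + r)).
  apply: nonincreasing_is_cvgn; first exact: turan_ratio_nonincreasing.
  by exists 0 => _ [n _ <-]; rewrite divr_ge0 // ler0n.
by move=> /cvg_ex[l]; rewrite (cvg_shiftn r ratio) => /cvgP.
Qed.

Lemma turan_density_ge0 : 0 <= turan_density R Fam.
Proof.
apply: limr_ge; first exact: cvgP turan_ratio_cvg.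
by near=> m; rewrite divr_ge0 // ler0n.
Unshelve. all: by end_near. Qed.

Lemma turan_density_le_ex (n : nat) :
  turan_density R Fam * 'C(n, r)%:R <= (ex_turan n Fam)%:R.
Proof.
have [nr|rn] := ltnP n r; first by rewrite bin_small // mulr0 ler0n.
rewrite -ler_pdivlMr ?ltr0n ?bin_gt0 // -/(ratio n).
have cvg_shift : (fun m => ratio (m + r)) @ \oo --> turan_density R Fam.
  by have := turan_ratio_cvg; rewrite -(cvg_shiftn r).
have := nonincreasing_cvgn_ge turan_ratio_nonincreasing
  (cvgP _ cvg_shift) (n - r)%N.
by rewrite (cvg_lim _ cvg_shift) // subnK.
Qed.

(** The constant [D] absorbs the small [n], so the bound holds for every [n]; it is later applied to
    part sizes that may be small. *)
Lemma ex_le_turan_density (eps : R) : 0 < eps ->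
  exists D : R, forall n : nat,
    (ex_turan n Fam)%:R <= (turan_density R Fam + eps) * 'C(n, r)%:R + D.
Proof.
move=> eps_gt0.
have : \forall n \near \oo, ratio n <= turan_density R Fam + eps.
  by apply: cvgr_le turan_ratio_cvg _ _; rewrite ltrDl.
move=> [N _ HN]; exists 'C(N + r, r)%:R => n.
have [nN|Nn] := leqP n (N + r).
  apply: ler_wpDl; first by rewrite mulr_ge0 ?ler0n // addr_ge0 ?turan_density_ge0 // ltW.
  by rewrite ler_nat (leq_trans (ex_turan_le_bin _ _)) // leq_bin2l.
apply: ler_wpDr; first by rewrite ler0n.
rewrite -ler_pdivrMr ?ltr0n ?bin_gt0; last by lia.
by apply: HN => /=; lia.
Qed.

Lemma turan_density_le1 : turan_density R Fam <= 1.
Proof.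
apply: limr_le; first exact: cvgP turan_ratio_cvg.
near=> m; rewrite ler_pdivrMr ?mul1r ?ler_nat ?ex_turan_le_bin //.
rewrite ltr0n bin_gt0; near: m; exact: nbhs_infty_ge.
Unshelve. all: by end_near. Qed.

(** On [n + r] vertices the binomial is positive, so positive density forces a free graph there; the
    edgeless graph on [n] of its vertices is then free too. *)
Lemma exists_family_free (n : nat) : 0 < turan_density R Fam ->
  exists E : {set {set 'I_n}}, edges_of_size r E /\ family_free Fam E.
Proof.
move=> t_gt0; pose N := (n + r)%N.
have /existsP[E /asboolP[szE freeE]] : [exists E : {set {set 'I_N}},
    `[< edges_of_size r E /\ family_free Fam E >]].
  apply: contraT; rewrite negb_exists => /forallP noE.
  have := turan_density_le_ex N; rewrite /ex_turan big1 => [|E]; last first.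
    by rewrite (negPf (noE E)).
  by rewrite leNgt mulr_gt0 // ltr0n bin_gt0 leq_addl.
exists finset.set0; split=> [e|F FamF [f injf copy]]; first by rewrite inE.
apply: (freeE F FamF); exists (fun v => lshift r (f v)).
  by move=> u v /lshift_inj/injf.
by move=> e /copy; rewrite inE.
Qed.

End Density.

Lemma turan_density_set0 (R : realType) (r : nat) :
  turan_density R (@set0 (rgraph r)) = 1.
Proof.
apply: (@cvg_lim R) => //; apply: cvg_near_cst; near=> n.
rewrite ex_turan_set0 divff // pnatr_eq0 -lt0n bin_gt0.
by near: n; exact: nbhs_infty_ge.
Unshelve. all: by end_near. Qed.

(** * The density of [partite_family] *)

Lemma cvg_inv_pinfty (R : realType) (f : nat -> R) :
  (forall A, \forall q \near \oo, A <= f q) -> (fun q => (f q)^-1) @ \oo --> 0.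
Proof.
move=> finf; apply/gtr0_cvgV0; last by apply/cvgryPge.
by apply: filterS (finf 1) => q; apply: lt_le_trans.
Qed.

Lemma natr_ge_near (R : realType) (A : R) : \forall q \near \oo, A <= q%:R.
Proof. by move/cvgryPge: (@cvgr_idn R); apply. Qed.

(** Induction on [r]: passing from [r] to [r + 1] multiplies the ratio by [(q - r) / (k q - r)],
    which tends to [1 / k]. *)
Lemma bin_ratio_cvg (R : realType) (k r : nat) : (0 < k)%N ->
  (fun q => 'C(q, r)%:R / 'C(k * q, r)%:R : R) @ \oo --> (k%:R ^- r : R).
Proof.
move=> k_gt0; have k0 : k%:R != 0 :> R by rewrite pnatr_eq0 -lt0n.
have k1 : 1 <= k%:R :> R by rewrite ler1n.
elim: r => [|r IH].
  rewrite expr0 invr1; apply: cvg_near_cst; near=> q.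
  by rewrite !bin0 divr1.
(* [g q] is [(q - r) / (k q - r)] rearranged so that its limit is visible. *)
pose g (q : nat) : R :=
  k%:R^-1 - (r%:R * (k%:R - 1) / k%:R) * (k%:R * q%:R - r%:R)^-1.
have g_cvg : g @ \oo --> (k%:R^-1 : R).
  rewrite -[X in _ --> X]subr0 -[X in _ - X](mulr0 (r%:R * (k%:R - 1) / k%:R)).
  apply: cvgB; first exact: cvg_cst.
  apply: cvgM; first exact: cvg_cst.
  apply: cvg_inv_pinfty => A; apply: filterS (natr_ge_near (A + r%:R)) => q.
  by have : 0 <= q%:R :> R by []; nra.
rewrite exprS invfM.
apply: cvg_trans (cvgM g_cvg IH).
apply: near_eq_cvg; near=> q => /=.
have rq : (r < q)%N by near: q; exact: nbhs_infty_gt.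
have rkq : (r < k * q)%N by nia.
have eq1 n : (r < n)%N ->
    'C(n, r.+1)%:R = (n%:R - r%:R) * 'C(n, r)%:R / r.+1%:R :> R.
  move=> rn; apply: (mulfI (_ : r.+1%:R != 0 :> R)); first by rewrite pnatr_eq0.
  rewrite [RHS]mulrC divfK ?pnatr_eq0 // -natrM mul_bin_left natrM natrB //.
  exact: ltnW.
have neq0 n : (r < n)%N -> 'C(n, r)%:R != 0 :> R.
  by move=> rn; rewrite pnatr_eq0 -lt0n bin_gt0 ltnW.
have sub0 : k%:R * q%:R - r%:R != 0 :> R.
  by rewrite -natrM subr_eq0 eqr_nat gtn_eqF.
rewrite /g !eq1 // natrM; field.
by rewrite k0 sub0 neq0 // nat1r pnatr_eq0.
Unshelve. all: by end_near. Qed.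

(** Both bounds are read off at the multiples [n = k q], where the parts can be exactly balanced;
    the limit along this subsequence is already the density. *)
Lemma turan_density_partite_family (R : realType) (r k : nat)
    (Fam : set (rgraph r)) :
  (0 < r)%N -> (0 < k)%N -> 0 < turan_density R Fam ->
  turan_density R (partite_family k Fam) =
    1 - (1 - turan_density R Fam) / k%:R ^+ r.-1.
Proof.
move=> r_gt0 k_gt0 x_gt0; set x := turan_density R Fam.
set y := turan_density R _.
have k1 : 1 <= k%:R :> R by rewrite ler1n.
have k0 : k%:R != 0 :> R by rewrite pnatr_eq0 -lt0n.
(* The proportion, among all [r]-sets of [k q] points, of those inside one of [k] parts of size
   [q]. *)
pose w (q : nat) : R := k%:R * ('C(q, r)%:R / 'C(k * q, r)%:R).
have w_cvg : w @ \oo --> (k%:R ^- r.-1 : R).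
  have -> : k%:R ^- r.-1 = k%:R * k%:R ^- r :> R.
    by rewrite -[in RHS](prednK r_gt0) exprS invfM mulrA divff // mul1r.
  by apply: cvgM; [exact: cvg_cst | exact: bin_ratio_cvg].
pose v (q : nat) : R :=
  (ex_turan (k * q) (partite_family k Fam))%:R / 'C(k * q, r)%:R.
have v_cvg : v @ \oo --> y.
  have := @turan_ratio_cvg R r (partite_family k Fam).
  apply: cvg_comp => A [N _ HN]; exists N => // q /= Nq; apply: HN => /=.
  by rewrite (leq_trans Nq) // leq_pmull.
have wP (q : nat) : (r <= q)%N -> w q * 'C(k * q, r)%:R = k%:R * 'C(q, r)%:R.
  move=> rq; rewrite /w mulrA divfK // pnatr_eq0 -lt0n bin_gt0.
  by rewrite (leq_trans rq) // leq_pmull.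
have C_gt0 (q : nat) : (r <= q)%N -> 0 < 'C(k * q, r)%:R :> R.
  by move=> rq; rewrite ltr0n bin_gt0 (leq_trans rq) // leq_pmull.
apply/eqP; rewrite eq_le; apply/andP; split; last first.
  have lb_cvg : (fun q => 1 - (1 - x) * w q) @ \oo -->
      1 - (1 - x) / k%:R ^+ r.-1.
    by apply: cvgB; [exact: cvg_cst|apply: cvgM => //; exact: cvg_cst].
  apply: (ler_cvg_to lb_cvg v_cvg); near=> q.
  have rq : (r <= q)%N by near: q; exact: nbhs_infty_ge.
  rewrite ler_pdivlMr ?C_gt0 // mulrBl mul1r -mulrA wP //.
  have := ex_partite_family_ge k (@exists_family_free R r Fam q x_gt0).
  rewrite -(ler_nat R) !natrD !natrM.
  have := turan_density_le_ex R Fam q; rewrite -/x.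
  by nra.
have x1 : x <= 1 := turan_density_le1 R Fam.
have kr1 : 1 <= k%:R ^+ r.-1 :> R by rewrite exprn_ege1.
apply/ler_addgt0Pr => eps eps_gt0.
(* Jensen's bound is going to be multiplied by [1 - x - eps]. If that is negative, [x + eps > 1] and
   the claim follows from [y <= 1]. *)
have [d_lt0|d_ge0] := ltP (1 - x - eps) 0.
  have y1 : y <= 1 := turan_density_le1 R _.
  have : (1 - x) / k%:R ^+ r.-1 <= 1 - x.
    by rewrite ler_pdivrMr ?(lt_le_trans ltr01) // ler_peMr // subr_ge0.
  by lra.
have [D HD] := @ex_le_turan_density R r Fam eps eps_gt0.
pose u (q : nat) : R := k%:R * D * ('C(k * q, r)%:R)^-1.
have u_cvg : u @ \oo --> (0 : R).
  rewrite -[X in _ --> X](mulr0 (k%:R * D)); apply: cvgM; first exact: cvg_cst.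
  apply: cvg_inv_pinfty => A; near=> q.
  have Aq : A + r%:R <= q%:R by near: q; exact: natr_ge_near.
  apply: (@le_trans _ _ (q%:R - r%:R)); first by rewrite lerBrDr.
  rewrite lerBlDr -natrD ler_nat.
  have binr : 'C(r, r.-1) = r by rewrite -{1}(prednK r_gt0) binSn prednK.
  (* The tangent at [r] gives [C(n, r) >= 1 + r (n - r)], hence at least linear growth. *)
  have := bin_tangent r r.-1 (k * q); rewrite prednK // binn binr.
  have : (q <= k * q)%N by rewrite leq_pmull.
  by move: (k * q)%N 'C(_, r) => n c; nia.
have ub_cvg : (fun q => 1 - (1 - x - eps) * w q + u q) @ \oo -->
    1 - (1 - x - eps) / k%:R ^+ r.-1 + 0.
  apply: cvgD => //.
  by apply: cvgB; [exact: cvg_cst|apply: cvgM => //; exact: cvg_cst].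
apply: (@le_trans _ _ (1 - (1 - x - eps) / k%:R ^+ r.-1 + 0)); last first.
  have : eps / k%:R ^+ r.-1 <= eps.
    by rewrite ler_pdivrMr ?(lt_le_trans ltr01) // ler_peMr // ltW.
  by lra.
apply: (ler_cvg_to v_cvg ub_cvg); near=> q.
have rq : (r <= q)%N by near: q; exact: nbhs_infty_ge.
rewrite ler_pdivrMr ?C_gt0 // mulrDl mulrBl mul1r -mulrA wP // /u.
rewrite divfK ?gt_eqF ?C_gt0 //.
have [m sum_m] := ex_partite_family_le (k * q) Fam r_gt0 k_gt0.
have := sum_bin_ge r_gt0 sum_m.
rewrite -!(ler_nat R) !natrD natrM => sum_ge.
(* The Turan numbers of the parts are traded for binomials; the sum of binomials then has
   coefficient [-(1 - x - eps)], so balanced parts are the worst case. *)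
have : (\sum_(i < k) ex_turan (m i) Fam)%:R <=
    (x + eps) * (\sum_(i < k) 'C(m i, r))%:R + k%:R * D.
  rewrite !natr_sum mulr_sumr mulr_natl -[k in D *+ k]card_ord -sumr_const.
  by rewrite -big_split /=; apply: ler_sum => i _; apply: HD.
by nra.
Unshelve. all: by end_near. Qed.

(** * Filling a left neighbourhood of 1 *)

Lemma Pi_infty_bounds (R : realType) (r : nat) (x : R) :
  Pi_infty R r x -> 0 <= x <= 1.
Proof. by case=> Fam _ <-; rewrite turan_density_ge0 turan_density_le1. Qed.

Lemma Pi_infty_partite (R : realType) (r k : nat) (x : R) :
  (0 < r)%N -> (0 < k)%N -> 0 < x -> Pi_infty R r x ->
  Pi_infty R r (1 - (1 - x) / k%:R ^+ r.-1).
Proof.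
move=> r_gt0 k_gt0 x_gt0 [Fam _ xE]; rewrite -xE in x_gt0 *.
by exists (partite_family k Fam) => //; apply: turan_density_partite_family.
Qed.

(** Bernoulli's inequality [(1 - 1/(k+1))^n >= 1 - n/(k+1)], cleared of denominators. *)
Lemma succ_exp_le (R : realFieldType) (k : R) (n : nat) : 0 <= k ->
  (k + 1 - n%:R) * (k + 1) ^+ n <= (k + 1) * k ^+ n.
Proof.
move=> k_ge0; elim: n => [|n IH]; first by rewrite !expr0; lra.
rewrite !exprS -natr1.
have kn_ge0 : 0 <= (k + 1) ^+ n by apply: exprn_ge0; lra.
have : (k - n%:R) * (k + 1) * (k + 1) ^+ n <= k * (k + 1 - n%:R) * (k + 1) ^+ n.
  by apply: ler_wpM2r => //; have : 0 <= n%:R :> R by []; nra.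
have := ler_wpM2l k_ge0 IH.
by lra.
Qed.

(** Take the largest [k] with [t k^n <= A]. Then [t (k+1)^n > A], and for large [k] consecutive
    powers are so close in ratio that [t k^n] is still at least [B]. *)
Lemma exists_exp_between (R : realType) (n : nat) (A B : R) :
  (0 < n)%N -> 0 <= B -> B < A -> exists2 delta : R, 0 < delta &
  forall t, 0 < t <= delta ->
    exists2 k : nat, (0 < k)%N & B <= t * k%:R ^+ n <= A.
Proof.
move=> n_gt0 B_ge0 BA; have A_gt0 : 0 < A by lra.
(* Chosen so that [B / A <= 1 - n / (k + 1)] for all [k >= K]. *)
pose K := (Num.bound (A * n%:R / (A - B))).+1.
have KP : A * n%:R <= (A - B) * K%:R.
  rewrite mulrC [leRHS]mulrC -ler_pdivrMr ?subr_gt0 // mulrC.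
  rewrite ltW // (lt_le_trans (archi_boundP _)) ?ler_nat //.
  by rewrite divr_ge0 ?mulr_ge0 ?ler0n // ?subr_ge0 ltW.
have Kn_gt0 : 0 < K%:R ^+ n :> R by rewrite exprn_gt0 // ltr0n.
(* For [t] up to this value [t K^n <= A], so the largest admissible [k] is at least [K]. *)
exists (A / K%:R ^+ n); first exact: divr_gt0.
move=> t /andP[t_gt0 t_le].
pose P (k : nat) := t * k%:R ^+ n <= A.
have PK : P K by rewrite /P -ler_pdivlMr.
have P_bounded k : P k -> (k <= Num.bound (A / t))%N.
  case: k => // k Pk; rewrite -(ler_nat R).
  have kn : k.+1%:R <= k.+1%:R ^+ n :> R.
    by rewrite -[leLHS]expr1 ler_weXn2l // ler1n.
  apply: (@le_trans _ _ (A / t)).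
    rewrite ler_pdivlMr // mulrC; apply: le_trans Pk.
    by rewrite ler_wpM2l // ltW.
  by rewrite ltW // archi_boundP // divr_ge0 ?ltW.
have [k Pk k_max] := ex_maxnP (ex_intro P K PK) P_bounded.
have Kk : (K <= k)%N := k_max K PK.
exists k; first exact: leq_trans Kk.
apply/andP; split; last exact: Pk.
have : ~~ P k.+1 by apply/negP => /k_max; rewrite ltnn.
rewrite /P -ltNge -natr1 => A_lt.
have KkR : K%:R <= k%:R :> R by rewrite ler_nat.
have k_ge0 : 0 <= k%:R :> R by [].
have := succ_exp_le n k_ge0; set N := n%:R; set k1n := (_ + 1) ^+ n => le_kn.
have le1 : B * (k%:R + 1) <= A * (k%:R + 1 - N) by rewrite -/N in KP *; nra.
have d_ge0 : 0 <= k%:R + 1 - N.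
  rewrite -(pmulr_rge0 _ A_gt0); apply: le_trans le1.
  by rewrite mulr_ge0 // addr_ge0.
have k1_gt0 : 0 < k%:R + 1 :> R by lra.
rewrite -(ler_pM2r k1_gt0); apply: le_trans le1 _.
apply: (@le_trans _ _ (t * k1n * (k%:R + 1 - N))).
  by apply: ler_wpM2r => //; exact: ltW.
by have := ler_wpM2l (ltW t_gt0) le_kn; lra.
Qed.

Theorem theorem5p1 (R : realType) (r : nat) (hr : (3 <= r)%N) (a b : R)
    (hab : a < b) (hPi : `[a, b]%classic `<=` Pi_infty R r) :
  exists2 delta : R, 0 < delta & `[1 - delta, 1]%classic `<=` Pi_infty R r.
Proof.
have /Pi_infty_bounds/andP[a_ge0 _] : Pi_infty R r a.
  by apply: hPi; rewrite /= in_itv /= lexx ltW.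
have /Pi_infty_bounds/andP[_ b_le1] : Pi_infty R r b.
  by apply: hPi; rewrite /= in_itv /= lexx ltW.
(* The midpoint in place of [a] keeps the source density positive even when [a = 0], as the partite
   construction requires. *)
have [|||delta delta_gt0 deltaP] :=
    @exists_exp_between R r.-1 (1 - (a + b) / 2) (1 - b); [by lia|lra|lra|].
exists delta => // y; rewrite /= in_itv /= => /andP[y_ge y_le1].
(* The choice of [k] needs [1 - y > 0]; the endpoint 1 comes from the empty family. *)
have [->|y_neq1] := eqVneq y 1.
  by exists set0 => //; apply: turan_density_set0.
have y_lt1 : y < 1 by rewrite lt_neqAle y_neq1.
have [|k k_gt0 /andP[k_ge k_le]] := deltaP (1 - y).
  by apply/andP; split; lra.
(* The density that the construction with [k] parts sends to [y]; the choice of [k] puts it between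
   [(a + b) / 2] and [b]. *)
pose x := 1 - (1 - y) * k%:R ^+ r.-1.
have -> : y = 1 - (1 - x) / k%:R ^+ r.-1.
  by rewrite /x subKr mulfK ?subKr // expf_neq0 // pnatr_eq0 -lt0n.
apply: Pi_infty_partite => //; first by lia.
  by rewrite /x; lra.
by apply: hPi; rewrite /= in_itv /= /x; apply/andP; split; lra.
Qed.
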